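(* Let $U\subseteq\mathbb{R}^3$ be open and let $f:U\to\mathbb{R}$ be a smooth function which admits a smooth conjugate function $g:U\to\mathbb{R}$. Then $X(f)=X(g)$ on $U$.
   Context: Two smooth real functions $f,g$ are conjugate if $\|\nabla f\|=\|\nabla g\|$ and $\langle\nabla f,\nabla g\rangle=0$ (Euclidean metric). Indices run over $1,2,3$ and refer to standard coordinates on $\mathbb{R}^3$; they are raised and lowered with the Euclidean metric and repeated indices are summed. For a smooth function $f$ with first and second partial derivatives $f_i$, $f_{ij}$, $$X(f)=2f_i{}^jf_jf^{ik}f_k-f^if_i\,f^{jk}f_{jk}+f^if_i(f^j{}_j)^2 .$$ *)

(* Defs.v *)
From HB Require Import structures.
From mathcomp Require Export all_boot all_order all_algebra.
From mathcomp Require Export all_classical all_reals all_analysis.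
Export Order.TTheory GRing.Theory Num.Theory.
Export numFieldNormedType.Exports.

#[export] Set Implicit Arguments.
#[export] Unset Strict Implicit.
#[export] Unset Printing Implicit Defensive.

#[global] Open Scope classical_set_scope.
#[global] Open Scope ring_scope.

Section Defs.
Variable R : realType.

(* Points of R^3 are row vectors, with coordinates indexed by 0, 1, 2.
   A function on an open set U is represented by a total function on R^3;
   since U is open, its partial derivatives at points of U do not depend
   on the values taken outside U. *)
Implicit Types (U : set 'rV[R]_3) (f g : 'rV[R]_3 -> R) (x : 'rV[R]_3).

Definition pd (i : 'I_3) f : 'rV[R]_3 -> R := 'D_(delta_mx 0 i) f.

Definition iterpd (s : seq 'I_3) f : 'rV[R]_3 -> R := foldr pd f s.

(* The operator 'D_v is total, so existence of the partial derivatives has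
   to be required explicitly. The case s = [::] gives continuity of f. *)
Definition smooth_on U f : Prop :=
  forall (s : seq 'I_3) x, U x ->
    {for x, continuous (iterpd s f)} /\
    forall i : 'I_3, derivable (iterpd s f) x (delta_mx 0 i).

Definition grad f x : 'rV[R]_3 := \row_i pd i f x.

Definition dot (u v : 'rV[R]_3) : R := \sum_i u 0 i * v 0 i.

(* The norm `|u| on 'rV[R]_3 is the sup norm, not the Euclidean one. *)
Definition enorm (u : 'rV[R]_3) : R := Num.sqrt (dot u u).

Definition conjugate_on U f g : Prop :=
  forall x, U x ->
    enorm (grad f x) = enorm (grad g x) /\ dot (grad f x) (grad g x) = 0.

Definition pd2 (i j : 'I_3) f : 'rV[R]_3 -> R := pd j (pd i f).

(* 2 f_i^j f_j f^{ik} f_k - f^i f_i f^{jk} f_{jk} + f^i f_i (f^j_j)^2: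
   raising and lowering indices with the Euclidean metric does not change
   components, and each repeated index is summed. *)
Definition X f x : R :=
  2 * (\sum_i \sum_j \sum_k pd2 i j f x * pd j f x * (pd2 i k f x * pd k f x))
  - (\sum_i pd i f x * pd i f x) * (\sum_j \sum_k pd2 j k f x * pd2 j k f x)
  + (\sum_i pd i f x * pd i f x) * (\sum_j pd2 j j f x) ^+ 2.

End Defs.

(* Main.v *)
Require Import Defs.
From mathcomp Require Import ring lra complex.

(** Fix a point of U and write a, b for the gradients of f, g there and F, G
    for the Hessians. Since Hessians are symmetric,
      X(f) = 2 |aF|^2 + |a|^2 ((tr F)^2 - tr (F^2)).
    Differentiating |a|^2 = |b|^2 and a.b = 0 gives aF = bG and bF = - aG
    ([conjugate_hess]), so the first terms and the factors |a|^2 agree. It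
    remains to compare (tr F)^2 - tr (F^2), which is twice the second
    elementary symmetric function sigma_2 of the eigenvalues, with the same
    expression in G, at a point where a is not 0.

    For this put w = a + i b and H = F + i G. The four relations between
    a, b, F and G say exactly that w.w = 0 and wH = 0. A symmetric matrix H of
    size 3 killed by a nonzero vector w has adjugate proportional to w^T w, so
    sigma_2(H) = tr (adj H) is proportional to w.w and vanishes
    ([trace_sqr_null_kernel]). As sigma_2 is a quadratic form, the real part
    of sigma_2(F + i G) is sigma_2(F) - sigma_2(G), hence the theorem.

    The symmetry of the Hessian is essential here and is proved as Schwarz's
    theorem ([derive_comm]) for directional derivatives, by applying the mean
    value theorem twice to a second difference. *)

(** * Symmetry of second directional derivatives *)

Section Schwarz.
Variables (R : realType) (V : normedModType R).
Implicit Types (h : V -> R) (u v x : V) (U : set V).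

Lemma is_derive_line h x v (s : R) :
  derivable h (x + s *: v) v ->
  is_derive s 1 (fun t => h (x + t *: v)) ('D_v h (x + s *: v)).
Proof.
move=> dh.
have E : (fun k : R => k^-1 *: (((fun t => h (x + t *: v)) \o shift s) (k *: 1) - h (x + s *: v)))
       = (fun k : R => k^-1 *: ((h \o shift (x + s *: v)) (k *: v) - h (x + s *: v))).
  by apply/funext => k /=; rewrite [k%:A]mulr1 scalerDl addrCA.
by split; rewrite /derivable /derive E.
Qed.

Definition second_difference h u v (e : R) x : R :=
  h (x + e *: u + e *: v) - h (x + e *: u) - (h (x + e *: v) - h x).

Lemma second_differenceC h u v e x :
  second_difference h u v e x = second_difference h v u e x.
Proof. by rewrite /second_difference (addrAC x); ring. Qed.

(** Two applications of the mean value theorem: first along u to the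
    difference of h on two parallel segments, then along v to 'D_u h. *)
Lemma second_difference_derive h u v (e : R) x U :
  0 < e ->
  (forall s t, 0 <= s <= e -> 0 <= t <= e -> U (x + s *: u + t *: v)) ->
  (forall y, U y -> derivable h y u) ->
  (forall y, U y -> derivable ('D_u h) y v) ->
  exists s t, [/\ 0 <= s <= e, 0 <= t <= e &
    second_difference h u v e x
      = 'D_v ('D_u h) (x + s *: u + t *: v) * (e * e)].
Proof.
move=> e0 Ubox du dvu.
have e00 : (0 : R) <= 0 <= e by rewrite lexx ltW.
have ee0 : 0 <= e <= e by rewrite lexx ltW.
pose phi := (fun s : R => h (x + e *: v + s *: u)) - (fun s : R => h (x + s *: u)).
have dphi s : s \in `[0, e]%R -> is_derive s 1 phi
    ('D_u h (x + e *: v + s *: u) - 'D_u h (x + s *: u)).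
  rewrite in_itv /= => se; apply: is_deriveB.
    by apply: is_derive_line; apply: du; rewrite addrAC; apply: Ubox.
  apply: is_derive_line; apply: du.
  by have := Ubox s 0 se e00; rewrite scale0r addr0.
have cphi : {within `[0, e], continuous phi}.
  by apply: derivable_within_continuous => s /dphi [].
have [s] := MVT e0 (fun s se => dphi s (subset_itv_oo_cc se)) cphi.
move=> /subset_itv_oo_cc; rewrite in_itv /= => se; rewrite subr0 => Ephi.
pose psi := fun t : R => 'D_u h (x + s *: u + t *: v).
have dpsi t : t \in `[0, e]%R ->
    is_derive t 1 psi ('D_v ('D_u h) (x + s *: u + t *: v)).
  rewrite in_itv /= => te.
  by apply: is_derive_line; apply: dvu; apply: Ubox.
have cpsi : {within `[0, e], continuous psi}.
  by apply: derivable_within_continuous => t /dpsi [].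
have [t] := MVT e0 (fun t te => dpsi t (subset_itv_oo_cc te)) cpsi.
move=> /subset_itv_oo_cc; rewrite in_itv /= => te; rewrite subr0 => Epsi.
exists s, t; split => //; rewrite mulrA -Epsi /psi scale0r addr0.
move: Ephi; rewrite /phi !fctE !scale0r !addr0 (addrAC x (e *: v)) => Ephi.
by rewrite /second_difference addrAC (addrAC x (s *: u)) -Ephi; ring.
Qed.

Lemma continuous_eq_of_common_values (P Q : V -> R) x :
  {for x, continuous P} -> {for x, continuous Q} ->
  (forall r, 0 < r -> exists y z, [/\ ball x r y, ball x r z & P y = Q z]) ->
  P x = Q x.
Proof.
move=> cP cQ PQ.
apply/eqP; rewrite -subr_eq0 -normr_le0; apply/ler_addgt0Pr => eps eps0.
have eps2 : 0 < eps / 2 by rewrite divr_gt0.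
have nP : \forall y \near x, `|P x - P y| < eps / 2 by exact: cvgr_dist_lt cP _ eps2.
have nQ : \forall y \near x, `|Q x - Q y| < eps / 2 by exact: cvgr_dist_lt cQ _ eps2.
have : nbhs x ([set y | `|P x - P y| < eps / 2] `&` [set y | `|Q x - Q y| < eps / 2]).
  exact: filterI nP nQ.
move=> /nbhs_ballP [r /= r0 xr].
have [y [z [/xr[/= Py _] /xr[/= _ Qz] PyQz]]] := PQ r r0.
rewrite add0r (_ : P x - Q x = (P x - P y) - (Q x - Q z)); last by rewrite PyQz; ring.
rewrite (le_trans (ler_normB _ _))//; lra.
Qed.

(** Schwarz's theorem. The second difference is symmetric in u and v, so on
    every small parallelogram the two mixed derivatives share a value, possibly
    at different points; continuity at x then identifies their values at x. *)
Lemma derive_comm h u v x U :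
  open U -> U x ->
  (forall y, U y -> derivable h y u) ->
  (forall y, U y -> derivable h y v) ->
  (forall y, U y -> derivable ('D_u h) y v) ->
  (forall y, U y -> derivable ('D_v h) y u) ->
  {for x, continuous ('D_v ('D_u h))} ->
  {for x, continuous ('D_u ('D_v h))} ->
  'D_v ('D_u h) x = 'D_u ('D_v h) x.
Proof.
move=> oU Ux du dv dvu duv cP cQ.
apply: (continuous_eq_of_common_values cP cQ) => r r0.
have /nbhs_ballP [r' /= r'0 xr'] : nbhs x U by exact: open_nbhs_nbhs.
(* The parallelogram with sides e u and e v must lie both in the ball of
   radius r and in U; adding 1 keeps the denominator positive. *)
pose e := Num.min r r' / (`|u| + `|v| + 1).
have n0 : 0 < `|u| + `|v| + 1 by rewrite ltr_wpDl// addr_ge0.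
have e0 : 0 < e by rewrite divr_gt0// lt_min r0.
have box s t : 0 <= s <= e -> 0 <= t <= e ->
    ball x (Num.min r r') (x + s *: u + t *: v).
  move=> /andP[s0 se] /andP[t0 te].
  rewrite -ball_normE /= -addrA opprD addNKr normrN.
  rewrite (le_lt_trans (ler_normD _ _))// !normrZ !ger0_norm//.
  have -> : Num.min r r' = e * (`|u| + `|v| + 1) by rewrite divfK// gt_eqF.
  by rewrite !mulrDr mulr1 ltr_pwDr// lerD ?ler_wpM2r.
have boxr s t : 0 <= s <= e -> 0 <= t <= e -> ball x r (x + s *: u + t *: v).
  by move=> se te; apply: le_ball (box s t se te); rewrite ge_min lexx.
have boxU s t : 0 <= s <= e -> 0 <= t <= e -> U (x + s *: u + t *: v).
  by move=> se te; apply/xr'/(le_ball _ (box s t se te)); rewrite ge_min lexx orbT.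
have [s [t [se te Euv]]] := second_difference_derive e0 boxU du dvu.
have boxU' s' t' (se' : 0 <= s' <= e) (te' : 0 <= t' <= e) :
  U (x + s' *: v + t' *: u) by rewrite addrAC; apply: boxU.
have [s' [t' [se' te' Evu]]] := second_difference_derive e0 boxU' dv duv.
exists (x + s *: u + t *: v), (x + s' *: v + t' *: u); split.
- exact: boxr.
- by rewrite addrAC; apply: boxr.
- apply: (@mulIf _ (e * e)); first by rewrite mulf_neq0 ?gt_eqF.
  exact: etrans (esym Euv) (etrans (second_differenceC _ _ _ _ _) Evu).
Qed.

End Schwarz.

(** * Symmetric matrices with an isotropic null vector *)

Lemma sum_ord3 (M : nmodType) (F : 'I_3 -> M) :
  \sum_i F i = F (inord 0) + F (inord 1) + F (inord 2).
Proof.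
rewrite !big_ord_recr big_ord0 /= add0r.
by do 2?[congr (_ + _)]; congr F; apply/val_inj; rewrite /= inordK.
Qed.

(** Let A be the adjugate of the symmetric matrix (a b c; b d e; c e f), so
    that the left factor is tr A. Cramer's rule for a null vector w = (x, y, z)
    gives A_11 w_k^2 = A_kk w_1^2; summing over k,
    (tr A) w_1^2 = A_11 (w.w) = 0. *)
Lemma sum_principal_minors_null_kernel (K : comPzRingType) (x y z a b c d e f : K) :
  x * a + y * b + z * c = 0 ->
  x * b + y * d + z * e = 0 ->
  x * c + y * e + z * f = 0 ->
  x ^+ 2 + y ^+ 2 + z ^+ 2 = 0 ->
  ((d * f - e ^+ 2) + (a * f - c ^+ 2) + (a * d - b ^+ 2)) * x ^+ 2 = 0.
Proof.
move=> e1 e2 e3 q.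
(* The coefficients of the three linear equations are those with which Cramer's
   rule expresses A_kk x^2 - A_11 w_k^2, for k = 2, 3. *)
transitivity ((d * f - e ^+ 2) * (x ^+ 2 + y ^+ 2 + z ^+ 2)
  + x * (d + f) * (x * a + y * b + z * c)
  + (z * e - x * b - y * f) * (x * b + y * d + z * e)
  + (y * e - x * c - z * d) * (x * c + y * e + z * f)); first by ring.
by rewrite q e1 e2 e3 !mulr0 !addr0.
Qed.

(** The difference of the two sides is twice the trace of the adjugate of H.
    The adjugate is a multiple of the rank one matrix w^T w, whose trace w.w
    vanishes. *)
Lemma trace_sqr_null_kernel (K : fieldType) (H : 'M[K]_3) (w : 'rV_3) :
  H^T = H -> w *m H = 0 -> w != 0 -> \sum_i w 0 i ^+ 2 = 0 ->
  (\tr H) ^+ 2 = \tr (H *m H).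
Proof.
move=> symH wH0 w0 ww0.
have sym i j : H i j = H j i by rewrite -[in LHS]symH mxE.
have wH j : \sum_i w 0 i * H i j = 0 by move/rowP/(_ j): wH0; rewrite !mxE.
have [k wk0] : exists k, w 0 k != 0.
  apply/existsP; apply: contraR w0 => /existsPn wz.
  by apply/eqP/rowP => k; rewrite mxE; apply/eqP/negPn/wz.
apply/eqP; rewrite -subr_eq0; apply/eqP/(mulIf (expf_neq0 2 wk0)); rewrite mul0r.
move: ww0 (wH (inord 0)) (wH (inord 1)) (wH (inord 2)).
rewrite /mxtrace !sum_ord3 !mxE !sum_ord3.
rewrite (sym (inord 1) (inord 0)) (sym (inord 2) (inord 0)).
rewrite (sym (inord 2) (inord 1)).
have : k = inord 0 \/ k = inord 1 \/ k = inord 2.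
  by case: k {wk0} => [[|[|[|//]]] k3]; [left|right;left|right;right];
    apply/val_inj; rewrite /= inordK.
set x := w 0 (inord 0); set y := w 0 (inord 1); set z := w 0 (inord 2).
set a := H (inord 0) (inord 0); set b := H (inord 0) (inord 1).
set c := H (inord 0) (inord 2); set d := H (inord 1) (inord 1).
set e := H (inord 1) (inord 2); set f := H (inord 2) (inord 2).
move=> kE q e1 e2 e3.
rewrite (_ : _ - _ = 2 * ((d * f - e ^+ 2) + (a * f - c ^+ 2) + (a * d - b ^+ 2)));
  last by ring.
rewrite -mulrA; apply/eqP; rewrite mulf_eq0; apply/orP; right; apply/eqP.
(* Permuting the coordinates turns the nonzero entry of w into the first. *)
case: kE => [->|[->|->]]; rewrite -/x -/y -/z.
- exact: (sum_principal_minors_null_kernel e1 e2 e3 q).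
- rewrite -[RHS](@sum_principal_minors_null_kernel _ y x z d b e a c f); first by ring.
  + by rewrite -[RHS]e2; ring.
  + by rewrite -[RHS]e1; ring.
  + by rewrite -[RHS]e3; ring.
  + by rewrite -[RHS]q; ring.
- rewrite -[RHS](@sum_principal_minors_null_kernel _ z x y f c e a b d); first by ring.
  + by rewrite -[RHS]e3; ring.
  + by rewrite -[RHS]e1; ring.
  + by rewrite -[RHS]e2; ring.
  + by rewrite -[RHS]q; ring.
Qed.

Section ComplexCombination.
Variable R : rcfType.
Import ComplexField.
Local Open Scope complex_scope.

(** The real part of [trace_sqr_null_kernel] for H = F + i G and w = a + i b. *)
Lemma trace_sqr_sub_eq (F G : 'M[R]_3) (a b : 'rV[R]_3) :
  F^T = F -> G^T = G ->
  a *m F = b *m G -> b *m F = - (a *m G) ->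
  a != 0 -> \sum_i a 0 i * a 0 i = \sum_i b 0 i * b 0 i ->
  \sum_i a 0 i * b 0 i = 0 ->
  (\tr F) ^+ 2 - \tr (F *m F) = (\tr G) ^+ 2 - \tr (G *m G).
Proof.
move=> symF symG aF bF a0 eqab ab0.
pose C := map_mx (real_complex R) : 'M[R]_3 -> 'M[R[i]]_3.
pose c := map_mx (real_complex R) : 'rV[R]_3 -> 'rV[R[i]]_3.
pose H : 'M[R[i]]_3 := C F + 'i%C *: C G.
pose w : 'rV[R[i]]_3 := c a + 'i%C *: c b.
have ii : 'i%C * 'i%C = -1 :> R[i] by rewrite -expr2 sqr_i.
have symH : H^T = H by rewrite /H linearD linearZ /= /C !matrix.map_trmx symF symG.
have wH : w *m H = 0.
  rewrite /w /H mulmxDl !mulmxDr -!scalemxAl -!scalemxAr scalerA ii scaleN1r.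
  rewrite /C /c -!map_mxM aF bF raddfN /= scalerN.
  by rewrite -opprD [X in _ - X]addrC subrr.
have w0 : w != 0.
  apply: contra_neq a0 => /rowP wE; apply/rowP => k.
  by move: (wE k); rewrite !mxE /=; simpc => -[].
have ww : \sum_i w 0 i ^+ 2 = 0.
  transitivity ((\sum_i (a 0 i * a 0 i - b 0 i * b 0 i))%:C
      + 'i%C * (\sum_i 2 * (a 0 i * b 0 i))%:C).
    rewrite !raddf_sum mulr_sumr -big_split; apply: eq_bigr => k _ /=.
    by rewrite !mxE expr2; simpc; congr (_ +i* _); ring.
  by rewrite sumrB -mulr_sumr eqab ab0 subrr !mulr0 addr0.
have trH : \tr H = \tr F +i* \tr G.
  by rewrite /H mxtraceD mxtraceZ !trace_map_mx; simpc.
have HH : H *m H = C (F *m F - G *m G) + 'i%C *: C (F *m G + G *m F).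
  rewrite /H mulmxDl !mulmxDr -!scalemxAl -!scalemxAr scalerA ii scaleN1r.
  rewrite /C raddfB raddfD /= -!map_mxM /= scalerDr.
  by rewrite [RHS]addrACA [X in _ = _ + X]addrC.
have := trace_sqr_null_kernel symH wH w0 ww.
rewrite trH HH mxtraceD mxtraceZ !trace_map_mx.
rewrite expr2; simpc => -[+ _]; rewrite raddfB /= -!expr2 => E.
lra.
Qed.
End ComplexCombination.

(** * Gradients and Hessians of conjugate functions *)

Section ConjugateFunctions.
Variable R : realType.
Implicit Types (f g : 'rV[R]_3 -> R) (U : set 'rV[R]_3).

Definition hess f x : 'M[R]_3 := \matrix_(i, j) pd2 i j f x.

Lemma trmx_hess U f x : open U -> smooth_on U f -> U x -> (hess f x)^T = hess f x.
Proof.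
move=> oU sf Ux; apply/matrixP => i j; rewrite !mxE.
apply: (derive_comm oU Ux) => [y Uy|y Uy|y Uy|y Uy||].
- exact: (sf [::] y Uy).2.
- exact: (sf [::] y Uy).2.
- exact: (sf [:: j] y Uy).2.
- exact: (sf [:: i] y Uy).2.
- exact: (sf [:: i; j] x Ux).1.
- exact: (sf [:: j; i] x Ux).1.
Qed.

Lemma gradE f x i : grad f x 0 i = pd i f x. Proof. exact: mxE. Qed.

Lemma grad_dot_grad U f g x : smooth_on U f -> smooth_on U g -> U x ->
  grad (fun y => dot (grad f y) (grad g y)) x
    = grad g x *m hess f x + grad f x *m hess g x.
Proof.
move=> sf sg Ux; apply/rowP => k; rewrite gradE.
have -> : (fun y => dot (grad f y) (grad g y)) = \sum_i (pd i f * pd i g).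
  by apply/funext => y; rewrite fct_sumE; apply: eq_bigr => i _; rewrite !gradE.
have df i : derivable (pd i f) x (delta_mx 0 k) by exact: (sf [:: i] x Ux).2.
have dg i : derivable (pd i g) x (delta_mx 0 k) by exact: (sg [:: i] x Ux).2.
rewrite [LHS]derive_sum => [|i].
  rewrite [in RHS]mxE [X in _ = X + _]mxE [X in _ = _ + X]mxE -big_split /=.
  apply: eq_bigr => i _; rewrite [LHS]deriveM// addrC.
  by congr (_ * _ + _ * _); rewrite mxE.
exact: derivableM.
Qed.

Lemma grad_eq_on_open U f g x : open U -> U x -> (forall y, U y -> f y = g y) ->
  grad f x = grad g x.
Proof.
move=> oU Ux fg; apply/rowP => k; rewrite !mxE /pd; apply: near_eq_derive.
by have : nbhs x U by [exact: open_nbhs_nbhs]; apply: filterS.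
Qed.

Lemma enorm_eq_dot (u v : 'rV[R]_3) : enorm u = enorm v -> dot u u = dot v v.
Proof.
have dge0 (w : 'rV[R]_3) : 0 <= dot w w by apply: sumr_ge0 => i _; rewrite -expr2 sqr_ge0.
by move=> /(congr1 (fun r => r ^+ 2)); rewrite !sqr_sqrtr.
Qed.

Lemma grad_cst (c : R) x : grad (fun=> c) x = 0.
Proof. by apply/rowP => k; rewrite !mxE /pd derive_cst. Qed.

Lemma X_hess f x : (hess f x)^T = hess f x ->
  X f x = 2 * dot (grad f x *m hess f x) (grad f x *m hess f x)
    + dot (grad f x) (grad f x)
      * (\tr (hess f x) ^+ 2 - \tr (hess f x *m hess f x)).
Proof.
move=> symH; rewrite /X mulrBr [X in _ = _ + X]addrC addrA.
have sym i j : pd2 i j f x = pd2 j i f x by move/matrixP/(_ j i): symH; rewrite !mxE.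
have -> : dot (grad f x) (grad f x) = \sum_i pd i f x * pd i f x.
  by apply: eq_bigr => i _; rewrite !mxE.
congr (_ * _ - _ * _ + _ * _ ^+ 2).
- apply: eq_bigr => i _; rewrite !mxE big_distrl /=; apply: eq_bigr => j _.
  rewrite big_distrr; apply: eq_bigr => k _.
  by rewrite !mxE (sym i j) (sym i k); congr (_ * _); rewrite mulrC.
- apply: eq_bigr => i _; rewrite !mxE; apply: eq_bigr => j _.
  by rewrite !mxE (sym i j).
- by apply: eq_bigr => i _; rewrite mxE.
Qed.

(** The gradient of |grad f|^2 is 2 (grad f) (hess f), so differentiating
    |grad f|^2 = |grad g|^2 gives the first relation up to a factor 2; the
    second is the gradient of grad f . grad g = 0. *)
Lemma conjugate_hess U f g x : open U -> smooth_on U f -> smooth_on U g ->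
  conjugate_on U f g -> U x ->
  grad f x *m hess f x = grad g x *m hess g x /\
  grad g x *m hess f x = - (grad f x *m hess g x).
Proof.
move=> oU sf sg fg Ux; split; last first.
  apply/eqP; rewrite -addr_eq0 -(grad_dot_grad sf sg Ux); apply/eqP.
  rewrite -[RHS](grad_cst 0 x); apply: (grad_eq_on_open oU Ux) => y Uy.
  exact: (fg y Uy).2.
have double_inj (p q : 'rV[R]_3) : p + p = q + q -> p = q.
  by move=> /rowP E; apply/rowP => i; move: (E i); rewrite !mxE; lra.
have E := grad_eq_on_open oU Ux (fun y Uy => enorm_eq_dot (fg y Uy).1).
apply: double_inj.
exact: etrans (esym (grad_dot_grad sf sf Ux)) (etrans E (grad_dot_grad sg sg Ux)).
Qed.

End ConjugateFunctions.

Theorem theorem12 (R : realType) (U : set 'rV[R]_3) (f g : 'rV[R]_3 -> R)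
    (U_open : open U) (f_smooth : smooth_on U f) (g_smooth : smooth_on U g)
    (fg_conj : conjugate_on U f g) :
  forall x, U x -> X f x = X g x.
Proof.
move=> x Ux.
have symF := trmx_hess U_open f_smooth Ux.
have symG := trmx_hess U_open g_smooth Ux.
have [aF bF] := conjugate_hess U_open f_smooth g_smooth fg_conj Ux.
have [/enorm_eq_dot ab ab0] := fg_conj x Ux.
rewrite (X_hess symF) (X_hess symG).
move: (grad f x) (grad g x) (hess f x) (hess g x) symF symG aF bF ab ab0.
move=> a b F G symF symG aF bF ab ab0.
rewrite -aF -ab; congr (_ + _).
have [->|a0] := eqVneq a 0.
  have -> : dot 0 0 = 0 :> R by apply: big1 => i _; rewrite mxE mul0r.
  by rewrite !mul0r.
by congr (_ * _); apply: (trace_sqr_sub_eq symF symG aF bF a0 ab ab0).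
Qed.
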